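(* Let $w_1,w_2,w_3$ be any positive integers. Then for every integer $n\ge 0$ and all $y_1,y_2\in\mathbb{Z}_p$, the following six expressions are equal (all sums run over nonnegative integers $k,l,m$ with $k+l+m=n$): \begin{align*} &\sum_{k+l+m=n}\binom{n}{k,l,m}B_{k,\chi,\xi^{w_2w_3}}(w_1y_1)\,B_{l,\chi,\xi^{w_1w_3}}(w_2y_2)\,S_m(dw_3-1;\chi,\xi^{w_1w_2})\,w_1^{l+m}w_2^{k+m}w_3^{k+l-1}\\ =&\sum_{k+l+m=n}\binom{n}{k,l,m}B_{k,\chi,\xi^{w_2w_3}}(w_1y_1)\,B_{l,\chi,\xi^{w_1w_2}}(w_3y_2)\,S_m(dw_2-1;\chi,\xi^{w_1w_3})\,w_1^{l+m}w_3^{k+m}w_2^{k+l-1}\\ =&\sum_{k+l+m=n}\binom{n}{k,l,m}B_{k,\chi,\xi^{w_1w_3}}(w_2y_1)\,B_{l,\chi,\xi^{w_2w_3}}(w_1y_2)\,S_m(dw_3-1;\chi,\xi^{w_1w_2})\,w_2^{l+m}w_1^{k+m}w_3^{k+l-1}\\ =&\sum_{k+l+m=n}\binom{n}{k,l,m}B_{k,\chi,\xi^{w_1w_3}}(w_2y_1)\,B_{l,\chi,\xi^{w_1w_2}}(w_3y_2)\,S_m(dw_1-1;\chi,\xi^{w_2w_3})\,w_2^{l+m}w_3^{k+m}w_1^{k+l-1}\\ =&\sum_{k+l+m=n}\binom{n}{k,l,m}B_{k,\chi,\xi^{w_1w_2}}(w_3y_1)\,B_{l,\chi,\xi^{w_1w_3}}(w_2y_2)\,S_m(dw_1-1;\chi,\xi^{w_2w_3})\,w_3^{l+m}w_2^{k+m}w_1^{k+l-1}\\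 =&\sum_{k+l+m=n}\binom{n}{k,l,m}B_{k,\chi,\xi^{w_1w_2}}(w_3y_1)\,B_{l,\chi,\xi^{w_2w_3}}(w_1y_2)\,S_m(dw_2-1;\chi,\xi^{w_1w_3})\,w_3^{l+m}w_1^{k+m}w_2^{k+l-1}. \end{align*}
   Context: Let $p$ be a fixed prime, $\mathbb{Z}_p$ the ring of $p$-adic integers, and $\mathbb{C}_p$ the completion of an algebraic closure of $\mathbb{Q}_p$. Let $\Gamma_r=\{\xi\in\mathbb{C}_p : \xi^{p^s}=1 \text{ for some } s\in\mathbb{Z}_{>0}\}$ (ramified roots of unity) and fix any $\xi\in\Gamma_r$. Let $d$ be a fixed positive integer and $\chi$ a (primitive) Dirichlet character of conductor $d$, viewed as a function $\mathbb{Z}\to\mathbb{C}_p$ via a fixed embedding $\overline{\mathbb{Q}}\to\mathbb{C}_p$ (periodic mod $d$, zero on integers not coprime to $d$; if $d=1$, $\chi\equiv 1$). For $\eta\in\Gamma_r$, the generalized twisted Bernoulli polynomials $B_{n,\chi,\eta}(x)$ attached to $\chi$ and $\eta$ are the polynomials in $x$ with coefficients in $\mathbb{C}_p$ defined by the power series expansion in $t$ $$\frac{te^{xt}}{\eta^{d}e^{dt}-1}\sum_{a=0}^{d-1}\chi(a)\eta^{a}e^{at}=\sum_{n=0}^{\infty}B_{n,\chi,\eta}(x)\frac{t^n}{n!}.$$ For integers $k,n\ge 0$ and $\eta\in\Gamma_r$, the $k$th generalized twisted power sum is $S_k(n;\chi,\eta)=\sum_{a=0}^{n}\chi(a)\eta^a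 a^k$, with the convention $0^0=1$. Also $\binom{n}{k,l,m}=\frac{n!}{k!\,l!\,m!}$. *)

(* Defs.v *)
From HB Require Import structures.
From mathcomp Require Import all_boot all_order all_algebra cyclic all_field.
From mathcomp Require Import boolp classical_sets reals.

Set Implicit Arguments.
Unset Strict Implicit.
Unset Printing Implicit Defensive.

Import Order.TTheory GRing.Theory Num.Theory.
Local Open Scope ring_scope.

Section PadicComplex.
Variables (R : realType) (K : fieldType) (v : K -> R).

(* Inside a complete K, the closure of the rationals for an absolute value
   extending the p-adic one is the completion Q_p. *)
Definition in_Qp (x : K) : Prop :=
  forall e : R, 0 < e -> exists q : rat, v (x - ratr q) < e.

Definition in_Zp (x : K) : Prop := in_Qp x /\ v x <= 1.

Definition in_Qpbar (x : K) : Prop :=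
  exists P : {poly K}, [/\ P != 0, forall i, in_Qp P`_i & root P x].

Definition cauchy_seq_for (u : nat -> K) : Prop :=
  forall e : R, 0 < e ->
    exists N, forall m n, (N <= m)%N -> (N <= n)%N -> v (u m - u n) < e.

Definition cvg_seq_for (u : nat -> K) (l : K) : Prop :=
  forall e : R, 0 < e -> exists N, forall n, (N <= n)%N -> v (u n - l) < e.

(* (K, v) is a completion of an algebraic closure of Q_p. The first five fields
   make v a non-archimedean absolute value which is the p-adic one on the
   rationals, normalized by |p| = 1/p (this also forces characteristic 0).
   Such a (K, v) is unique up to isometric isomorphism. *)
Record is_Cp (p : nat) : Prop := IsCp {
  Cp_ge0 : forall x, 0 <= v x;
  Cp_eq0 : forall x, v x = 0 <-> x = 0;
  Cp_mul : forall x y, v (x * y) = v x * v y;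
  Cp_ultra : forall x y, v (x + y) <= Num.max (v x) (v y);
  Cp_norm : v p%:R = p%:R^-1;
  Cp_complete : forall u, cauchy_seq_for u -> exists l, cvg_seq_for u l;
  Cp_closed : forall P : {poly K}, (forall i, in_Qpbar P`_i) ->
    (1 < size P)%N -> exists2 x, in_Qpbar x & root P x;
  Cp_dense : forall (x : K) (e : R), 0 < e ->
    exists2 y, in_Qpbar y & v (x - y) < e
}.

End PadicComplex.

Definition in_Gamma_r (K : fieldType) (p : nat) (xi : K) : Prop :=
  exists2 s, (0 < s)%N & xi ^+ (p ^ s) = 1.

Record dirichlet_char (d : nat) (chi : int -> algC) : Prop := DirichletChar {
  dirichlet_periodic : forall a, chi (a + d%:Z) = chi a;
  dirichlet_mul : forall a b, chi (a * b) = chi a * chi b;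
  dirichlet_neq0 : forall a, (chi a != 0) = coprimez a d%:Z
}.

(* A character of conductor d, taken modulo d: it is not induced by a
   character modulo a proper divisor of d. *)
Definition primitive_dirichlet (d : nat) (chi : int -> algC) : Prop :=
  dirichlet_char d chi /\
  forall (d' : nat) (chi' : int -> algC), (d' %| d)%N -> dirichlet_char d' chi' ->
    (forall a, coprimez a d%:Z -> chi a = chi' a) -> d' = d.

(* A power series in t is encoded by its sequence of coefficients. *)
Definition psmul (A : comNzRingType) (f g : nat -> A) : nat -> A :=
  fun n => \sum_(i < n.+1) f i * g (n - i)%N.

(* The quotient f / g in A[[t]], when it exists (by psmul_inj it is unique
   as soon as A is an integral domain and g <> 0). *)
Definition psdiv (A : comNzRingType) (f g : nat -> A) : nat -> A :=
  xget (fun=> 0) [set h : nat -> A | psmul g h = f]%classic.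

Section Bernoulli.
Variable K : fieldType.

(* The series e^(ct); c = 'X is the variable x of the Bernoulli polynomials. *)
Definition psexp (c : {poly K}) : nat -> {poly K} :=
  fun n => (n`!%:R)^-1 *: c ^+ n.

Definition bern_num (d : nat) (chi : int -> K) (eta : K) : nat -> {poly K} :=
  psmul (fun n => (n == 1)%:R)
    (psmul (psexp 'X)
       (fun n => \sum_(a < d) (chi a%:Z * eta ^+ a) *: psexp a%:R n)).

Definition bern_den (d : nat) (eta : K) : nat -> {poly K} :=
  fun n => eta ^+ d *: psexp d%:R n - (n == 0)%:R.

Definition gbern (d : nat) (chi : int -> K) (eta : K) (n : nat) : {poly K} :=
  n`!%:R *: psdiv (bern_num d chi eta) (bern_den d eta) n.

Definition gpsum (k n : nat) (chi : int -> K) (eta : K) : K :=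
  \sum_(0 <= a < n.+1) chi a%:Z * eta ^+ a * a%:R ^+ k.

Definition trisum (n : nat) (F : nat -> nat -> nat -> K) : K :=
  \sum_(k < n.+1) \sum_(l < n.+1) \sum_(m < n.+1 | (k + l + m == n)%N)
    n`!%:R / (k`! * l`! * m`!)%:R * F k l m.

End Bernoulli.

Lemma is_Cp_pchar0 (p : nat) (R : realType) (K : fieldType) (v : K -> R) :
  prime p -> is_Cp v p -> [pchar K] =i pred0.
Proof.
move=> p_pr HK q; rewrite [RHS]inE; apply/negP => qK.
have q_pr := pcharf_prime qK.
have v1 : v 1 = 1.
  have v1n0 : v 1 != 0 by apply/eqP => /(Cp_eq0 HK)/eqP; rewrite oner_eq0.
  by apply: (mulfI v1n0); rewrite -(Cp_mul HK) !mulr1.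
have vX x n : v (x ^+ n) = v x ^+ n.
  by elim: n => // n IH; rewrite !exprS (Cp_mul HK) IH.
have p0 : 0 < p%:R :> R by rewrite ltr0n prime_gt0.
have [e | neq_pq] := eqVneq p q.
  have /eqP := Cp_norm HK; rewrite e (pcharf0 qK) (iffRL (Cp_eq0 HK 0)) //.
  by rewrite -e eq_sym invr_eq0 (gt_eqF p0).
have cop : coprime p q by rewrite prime_coprime // dvdn_prime2.
have /(congr1 (fun k => v k%:R)) := Euler_exp_totient cop.
rewrite !(GRing.natr_mod_pchar qK) natrX vX v1 (Cp_norm HK) => /eqP.
rewrite lt_eqF // exprn_ilt1 ?invr_ge0 ?ltW //; last first.
  by rewrite invf_lt1 // ltr1n prime_gt1.
by rewrite -lt0n totient_gt0 prime_gt0.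
Qed.

Lemma psmul_inj (A : idomainType) (g h h' : nat -> A) :
  (exists n, g n != 0) -> psmul g h = psmul g h' -> h = h'.
Proof.
move=> exg E; case: (ex_minnP exg) => m gm mmin.
apply/funext; elim/ltn_ind => n IH.
have := congr1 (fun u : nat -> A => u (m + n)%N) E; rewrite /psmul.
have lt_m : (m < (m + n).+1)%N by rewrite ltnS leq_addr.
rewrite (bigD1 (Ordinal lt_m)) //= [in RHS](bigD1 (Ordinal lt_m)) //= addKn.
rewrite (eq_bigr (fun i : 'I_(m + n).+1 => g i * h' (m + n - i)%N)).
  by move/addIr/(mulfI gm).
move=> i neq_im; have [lt_im | le_mi] := ltnP i m.
  have [->|gi] := eqVneq (g i) 0; first by rewrite !mul0r.
  by have := mmin _ gi; rewrite leqNgt lt_im.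
have lt_mi : (m < i)%N.
  by rewrite ltn_neqAle le_mi andbT eq_sym; apply: contraNN neq_im => /eqP e; apply/eqP/val_inj.
by rewrite IH // ltn_subLR ?ltn_add2r // -ltnS.
Qed.

Lemma psdivE (A : idomainType) (f g : nat -> A) :
  (exists h, psmul g h = f) -> psmul g (psdiv f g) = f.
Proof. by move=> exh; apply: (xgetPex (fun=> 0) exh). Qed.

Fixpoint psdiv_seq (A : comUnitRingType) (f g : nat -> A) (n : nat) : seq A :=
  if n is m.+1 then
    let s := psdiv_seq f g m in
    rcons s ((g 0)^-1 * (f m - \sum_(i < m) g (m - i)%N * s`_i))
  else [::].

Lemma size_psdiv_seq (A : comUnitRingType) (f g : nat -> A) n :
  size (psdiv_seq f g n) = n.
Proof. by elim: n => //= n IH; rewrite size_rcons IH. Qed.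

Lemma nth_psdiv_seq (A : comUnitRingType) (f g : nat -> A) n i :
  (i < n)%N -> (psdiv_seq f g n)`_i = (psdiv_seq f g i.+1)`_i.
Proof.
elim: n => // n IH; rewrite ltnS leq_eqVlt => /predU1P[-> // | lt_in].
by rewrite [LHS]/= nth_rcons size_psdiv_seq lt_in IH.
Qed.

Lemma psdiv_unit_ex (A : comUnitRingType) (f g : nat -> A) :
  g 0 \is a GRing.unit -> exists h, psmul g h = f.
Proof.
move=> ug; exists (fun n => (psdiv_seq f g n.+1)`_n); apply/funext => n.
rewrite /psmul big_ord_recl /= subn0 nth_rcons size_psdiv_seq ltnn eqxx.
rewrite mulVKr //; apply/eqP; rewrite eq_sym -subr_eq; apply/eqP.
congr (_ - _); rewrite (reindex_inj rev_ord_inj) /=.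
apply: eq_bigr => i _; rewrite /bump /= add1n.
have -> : (n - (n - i.+1).+1 = i)%N by rewrite -subSn // subSS subKn // ltnW.
by rewrite subnSK // [in RHS]nth_psdiv_seq.
Qed.

Lemma bern_den_neq0 (K : fieldType) (d : nat) (eta : K) :
    [pchar K] =i pred0 -> (0 < d)%N -> eta != 0 ->
  exists n, bern_den d eta n != 0.
Proof.
move=> /pcharf0P K0 d_gt0 eta0; exists 1%N.
rewrite /bern_den /psexp subr0 (_ : 1`! = 1%N) // invr1 scale1r expr1.
by rewrite -polyC_natr scaler_eq0 polyC_eq0 K0 expf_eq0 (negbTE eta0) andbF eqn0Ngt d_gt0.
Qed.

(* The defining generating series identity
   (eta^d e^(dt) - 1) * sum_n B_n(x) t^n / n! = t e^(xt) sum_a chi(a) eta^a e^(at),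
   which determines the B_n by psmul_inj and bern_den_neq0. *)
Lemma gbernP (K : fieldType) (d : nat) (chi : int -> K) (eta : K) :
    [pchar K] =i pred0 -> (0 < d)%N ->
  psmul (bern_den d eta) (fun n => (n`!%:R)^-1 *: gbern d chi eta n)
    = bern_num d chi eta.
Proof.
move=> /pcharf0P K0 d_gt0.
have -> : (fun n => (n`!%:R)^-1 *: gbern d chi eta n)
          = psdiv (bern_num d chi eta) (bern_den d eta).
  apply/funext => n; rewrite /gbern scalerA mulVf ?scale1r // K0.
  by rewrite -lt0n fact_gt0.
apply: psdivE.
have den0 : bern_den d eta 0 = (eta ^+ d - 1)%:P.
  by rewrite /bern_den /psexp fact0 invr1 scale1r expr0 -alg_polyC scalerBl scale1r.
have [eta1 | eta1] := eqVneq (eta ^+ d) 1; last first.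
  apply: psdiv_unit_ex; rewrite den0 poly_unitE coefC eqxx size_polyC.
  by rewrite subr_eq0 eta1 unitfE subr_eq0 eta1.
have [| h hE] := @psdiv_unit_ex _ (fun n => bern_num d chi eta n.+1)
    (fun n => bern_den d eta n.+1).
  rewrite /bern_den /psexp eta1 scale1r subr0 (_ : 1`! = 1%N) // invr1 scale1r expr1.
  by rewrite -polyC_natr poly_unitE coefC eqxx size_polyC unitfE K0 -lt0n d_gt0.
exists h; apply/funext => -[|n].
  rewrite /psmul big_ord1 den0 eta1 subrr mul0r.
  by rewrite /bern_num [RHS]/psmul big_ord1 mul0r.
have /= <- := congr1 (fun u : nat -> {poly K} => u n) hE.
rewrite /psmul big_ord_recl den0 eta1 subrr mul0r add0r.
by apply: eq_bigr.
Qed.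

(* Main.v *)
(* Encode the six families by exponential generating series in t.  With
   z_i = xi^(w_j w_k) e^(w_j w_k t), for {i, j, k} = {1, 2, 3}, and
   A(z) = sum_(a < d) chi(a) z^a, each of the six generating series P satisfies
     (z_1^d - 1) (z_2^d - 1) (z_3^d - 1) P
       = w1 w2 w3 t^2 e^(w1 w2 w3 (y1 + y2) t) A(z_1) A(z_2) A(z_3) (Z^d - 1),
   where Z = z_1^w1 = z_2^w2 = z_3^w3.  This equation is symmetric in the
   weights, and the factors z_i^d - 1 are regular in K[[t]]. *)
From HB Require Import structures.
Require Import Defs.
From mathcomp Require Import all_boot all_order all_algebra all_field.
From mathcomp Require Import ring zify boolp reals.

Set Implicit Arguments.
Unset Strict Implicit.
Unset Printing Implicit Defensive.

Import Order.TTheory GRing.Theory Num.Theory.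
Local Open Scope ring_scope.

Lemma pchar0_natr_neq0 (K : fieldType) n :
  [pchar K] =i pred0 -> (0 < n)%N -> n%:R != 0 :> K.
Proof. by move=> /pcharf0P ->; rewrite -lt0n. Qed.

(** * The commutative ring K[[t]] of formal power series over a field K *)

Definition pseries (K : fieldType) : Type := nat -> K.

Section PowerSeriesRing.
Variable K : fieldType.
Implicit Types f g h : pseries K.

HB.instance Definition _ := Choice.copy (pseries K) (nat -> K).

Definition ps0 : pseries K := fun=> 0.
Definition psadd f g : pseries K := fun n => f n + g n.
Definition psopp f : pseries K := fun n => - f n.
Definition pscst (a : K) : pseries K := fun n => a * (n == 0)%:R.

Lemma psaddA : associative psadd.
Proof. by move=> f g h; apply/funext => n; apply: addrA. Qed.

Lemma psaddC : commutative psadd.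
Proof. by move=> f g; apply/funext => n; apply: addrC. Qed.

Lemma psadd0 : left_id ps0 psadd.
Proof. by move=> f; apply/funext => n; apply: add0r. Qed.

Lemma psaddN : left_inverse ps0 psopp psadd.
Proof. by move=> f; apply/funext => n; apply: addNr. Qed.

HB.instance Definition _ :=
  GRing.isZmodule.Build (pseries K) psaddA psaddC psadd0 psaddN.

(* Truncation to polynomials carries the ring axioms over from {poly K}. *)
Lemma psmul_coefM f g n (P Q : {poly K}) :
    (forall i, (i <= n)%N -> P`_i = f i) ->
    (forall i, (i <= n)%N -> Q`_i = g i) ->
  psmul f g n = (P * Q)`_n.
Proof.
move=> PE QE; rewrite coefM; apply: eq_bigr => i _.
by rewrite PE ?QE ?leq_subr // -ltnS.
Qed.

Definition pstrunc n f : {poly K} := \poly_(i < n.+1) f i.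

Lemma coef_pstrunc f n i : (i <= n)%N -> (pstrunc n f)`_i = f i.
Proof. by move=> le_in; rewrite coef_poly ltnS le_in. Qed.

Lemma psmul_trunc f g n i : (i <= n)%N ->
  (pstrunc n f * pstrunc n g)`_i = psmul f g i.
Proof.
move=> le_in; rewrite (@psmul_coefM f g i (pstrunc n f) (pstrunc n g)) // => j le_ji;
  by rewrite coef_pstrunc // (leq_trans le_ji).
Qed.

Lemma psmulA : associative (@psmul K).
Proof.
move=> f g h; apply/funext => n.
(* A product of two truncations is not itself a truncation, but it agrees with the product series
   through degree n, which is all that the coefficient of degree n reads. *)
rewrite (@psmul_coefM f (psmul g h) n (pstrunc n f) (pstrunc n g * pstrunc n h)).
- rewrite mulrA; symmetry; apply: psmul_coefM => i.
  + exact: psmul_trunc.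
  + exact: coef_pstrunc.
- exact: coef_pstrunc.
- by move=> i; apply: psmul_trunc.
Qed.

Lemma psmulC : commutative (@psmul K).
Proof. by move=> f g; apply/funext => n; rewrite -!(@psmul_trunc _ _ n n) // mulrC. Qed.

Lemma psmul_cstE a f : psmul (pscst a) f = fun n => a * f n.
Proof.
apply/funext => n; rewrite /psmul big_ord_recl subn0 big1 => [|i _].
  by rewrite /pscst mulr1 addr0.
by rewrite /pscst mulr0 mul0r.
Qed.

Lemma psmul1 : left_id (pscst 1) (@psmul K).
Proof. by move=> f; rewrite psmul_cstE; apply/funext => n; rewrite mul1r. Qed.

Lemma psmulDl : left_distributive (@psmul K) psadd.
Proof.
move=> f g h; apply/funext => n; rewrite /psmul /psadd -big_split /=.
by apply: eq_bigr => i _; rewrite mulrDl.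
Qed.

Lemma pscst1_neq0 : pscst 1 != 0.
Proof.
apply/eqP => /(congr1 (fun f : pseries K => f 0%N)) /eqP.
by rewrite /pscst mulr1 oner_eq0.
Qed.

HB.instance Definition _ := GRing.Zmodule_isComNzRing.Build (pseries K)
  psmulA psmulC psmul1 psmulDl pscst1_neq0.

Lemma psmulE f g : f * g = psmul f g. Proof. by []. Qed.

Lemma pssubE f g n : (f - g) n = f n - g n. Proof. by []. Qed.

Lemma psoneE n : (1 : pseries K) n = (n == 0)%:R.
Proof. exact: mul1r. Qed.

Lemma pssumE I (r : seq I) (P : pred I) (F : I -> pseries K) n :
  (\sum_(i <- r | P i) F i) n = \sum_(i <- r | P i) F i n.
Proof. exact: (big_morph (fun f : pseries K => f n)). Qed.

Lemma pscstE a f n : (pscst a * f) n = a * f n.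
Proof. by rewrite psmulE psmul_cstE. Qed.

Lemma pscstM a b : pscst (a * b) = pscst a * pscst b.
Proof. by apply/funext => n; rewrite pscstE /pscst mulrA. Qed.

(** Cancellation takes the place of inversion: [z ^+ d - 1] is not a unit of K[[t]] when its
    constant term vanishes, but it is still nonzero. *)
Lemma ps_lreg f : (exists n, f n != 0) -> GRing.lreg f.
Proof. by move=> f_neq0 g h /(psmul_inj f_neq0). Qed.

(** * Substitution of st for t, and exponential series *)

Definition psdil (s : K) f : pseries K := fun n => s ^+ n * f n.

Fact psdil_is_zmod_morphism s : zmod_morphism (psdil s).
Proof. by move=> f g; apply/funext => n; apply: mulrBr. Qed.

Fact psdil_is_monoid_morphism s : monoid_morphism (psdil s).
Proof.
split=> [|f g]; apply/funext => n.
  by rewrite psoneE /psdil psoneE; case: n => [|n]; rewrite ?mulr1 ?mulr0.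
rewrite psmulE /psdil /psmul big_distrr /=; apply: eq_bigr => i _.
have le_in : (i <= n)%N by rewrite -ltnS.
by rewrite mulrACA -exprD subnKC.
Qed.

HB.instance Definition _ s := GRing.isZmodMorphism.Build _ _ (psdil s)
  (psdil_is_zmod_morphism s).
HB.instance Definition _ s := GRing.isMonoidMorphism.Build _ _ (psdil s)
  (psdil_is_monoid_morphism s).

Lemma psdil_cst s a : psdil s (pscst a) = pscst a.
Proof. by apply/funext => -[|n]; rewrite /psdil /pscst ?mul1r // !mulr0. Qed.

Definition pst : pseries K := fun n => (n == 1)%:R.

Lemma psdil_t s : psdil s pst = pscst s * pst.
Proof.
by apply/funext => -[|[|n]]; rewrite pscstE /psdil /pst ?mulr0 ?expr1.
Qed.

Definition psexpt (c : K) : pseries K := fun n => (n`!%:R)^-1 * c ^+ n.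

Lemma psdil_expt s c : psdil s (psexpt c) = psexpt (s * c).
Proof. by apply/funext => n; rewrite /psdil /psexpt mulrCA exprMn. Qed.

Lemma psexpt0 : psexpt 0 = 1.
Proof.
apply/funext => -[|n]; rewrite psoneE /psexpt /=.
  by rewrite fact0 invr1 mul1r.
by rewrite expr0n mulr0.
Qed.

(** The series eta e^(st). Its powers keep this shape, so twisted character sums become polynomials
    in it. *)
Definition psgeo (eta s : K) : pseries K := pscst eta * psexpt s.

Lemma psdil_geo s eta r : psdil s (psgeo eta r) = psgeo eta (s * r).
Proof. by rewrite /psgeo rmorphM /= psdil_cst psdil_expt. Qed.

Hypothesis K0 : [pchar K] =i pred0.

Let natr_neq0 n : (0 < n)%N -> n%:R != 0 :> K.
Proof. exact: pchar0_natr_neq0. Qed.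

Let fact_neq0 n : n`!%:R != 0 :> K.
Proof. by rewrite natr_neq0 ?fact_gt0. Qed.

(** The binomial theorem divided by n!, the factorials being invertible in characteristic zero. *)
Lemma psexptD a b : psexpt (a + b) = psexpt a * psexpt b.
Proof.
apply/funext => n; rewrite psmulE /psexpt /psmul addrC exprDn big_distrr /=.
apply: eq_bigr => i _; have le_in : (i <= n)%N by rewrite -ltnS.
rewrite -(bin_fact le_in) !natrM -[(_ *+ _)]mulr_natr.
have bin_neq0 : 'C(n, i)%:R != 0 :> K.
  by rewrite natr_neq0 ?bin_gt0.
by field; rewrite !fact_neq0 bin_neq0.
Qed.

Lemma psgeoX eta s k : psgeo eta s ^+ k = psgeo (eta ^+ k) (k%:R * s).
Proof.
elim: k => [|k IH]; first by rewrite expr0 /psgeo mul0r psexpt0 mulr1.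
rewrite exprS IH exprS -add1n natrD mulrDl mul1r /psgeo pscstM psexptD.
ring.
Qed.

(** The coefficient of t is k s eta^k, which is nonzero even when eta^k = 1. *)
Lemma psgeoX_sub1_lreg eta s k : eta != 0 -> s != 0 -> (0 < k)%N ->
  GRing.lreg (psgeo eta s ^+ k - 1).
Proof.
move=> eta0 s0 k_gt0; apply: ps_lreg; exists 1%N.
rewrite psgeoX pssubE psoneE subr0 /psgeo pscstE /psexpt invr1 mul1r expr1.
by rewrite !mulf_neq0 ?expf_neq0 ?natr_neq0.
Qed.

(** The trinomial coefficient cancels the three factorials in F, which leaves a triple Cauchy
    product. *)
Lemma trisumM (f g h : pseries K) n (F : nat -> nat -> nat -> K) :
    (forall k l m, F k l m =
      (k`!%:R * f k) * (l`!%:R * g l) * (m`!%:R * h m)) ->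
  trisum n F = n`!%:R * (f * (g * h)) n.
Proof.
move=> FE; rewrite !psmulE /trisum /psmul big_distrr /=.
apply: eq_bigr => k _; have le_kn : (k <= n)%N by rewrite -ltnS.
(* For given k and l only m = n - k - l can contribute, and it exists exactly when l <= n - k. *)
have sum1 (l : 'I_n.+1) : \sum_(m < n.+1 | (k + l + m == n)%N)
      n`!%:R / (k`! * l`! * m`!)%:R * F k l m =
    if (l < (n - k).+1)%N then n`!%:R * (f k * (g l * h (n - k - l)%N)) else 0.
  case: ifPn => [|]; rewrite ltnS leq_subRL // => le_kln.
    have lt_m : (n - (k + l) < n.+1)%N by rewrite ltnS leq_subr.
    rewrite (big_pred1 (Ordinal lt_m)) => [|m] /=.
      rewrite FE subnDA !natrM; field.
      by rewrite !fact_neq0.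
    by rewrite -[RHS]val_eqE /= -[RHS](eqn_add2l (k + l)) subnKC.
  rewrite big_pred0 // => m; apply: contraNF le_kln => /eqP e.
  by rewrite -[X in (_ <= X)%N]e leq_addr.
rewrite (eq_bigr _ (fun l _ => sum1 l)) -big_mkcond /=.
rewrite -(big_ord_widen n.+1 (fun l => n`!%:R * (f k * (g l * h (n - k - l)%N)))).
  by rewrite !big_distrr.
by rewrite ltnS leq_subr.
Qed.

End PowerSeriesRing.

(** The sum splits into w blocks of length d, the j-th being z^(dj) times the first; the geometric
    sum of these factors telescopes against z^d - 1. *)
Lemma periodic_geometric_sum (A : comNzRingType) (c : nat -> A) (z : A)
    (d w : nat) :
    (forall a, c (a + d)%N = c a) ->
  (z ^+ d - 1) * (\sum_(a < d * w) c a * z ^+ a)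
    = (\sum_(a < d) c a * z ^+ a) * ((z ^+ w) ^+ d - 1).
Proof.
move=> cP; rewrite -exprM [(w * d)%N]mulnC.
elim: w => [|w IH]; first by rewrite muln0 big_ord0 expr0 subrr !mulr0.
have cPM a : c (d * w + a)%N = c a.
  by elim: w {IH} => [|w IH]; rewrite ?muln0 // mulnS -addnA addnC cP.
rewrite mulnS addnC big_split_ord /= mulrDr IH.
under [X in _ + _ * X]eq_bigr => a _ do rewrite cPM exprD mulrCA.
rewrite -big_distrr /= exprD; ring.
Qed.

(** * Generating series of the Bernoulli values and of the power sums *)

Section Generating.
Variables (K : fieldType) (d : nat) (chi : int -> K).
Hypothesis K0 : [pchar K] =i pred0.
Hypothesis d_gt0 : (0 < d)%N.
Hypothesis chiP : forall a, chi (a + d%:Z) = chi a.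

Let natr_neq0 n : (0 < n)%N -> n%:R != 0 :> K.
Proof. exact: pchar0_natr_neq0. Qed.

Let fact_neq0 n : n`!%:R != 0 :> K.
Proof. by rewrite natr_neq0 ?fact_gt0. Qed.

Definition chi_poly (z : pseries K) (N : nat) : pseries K :=
  \sum_(a < N) pscst (chi a%:Z) * z ^+ a.

(** With s a product of two weights, the dilation supplies powers of the weights in the six
    expressions. *)
Definition bern_gen (eta x s : K) : pseries K :=
  psdil s (fun n => (n`!%:R)^-1 * (gbern d chi eta n).[x]).

Definition gpsum_gen (N : nat) (eta s : K) : pseries K :=
  psdil s (fun m => (m`!%:R)^-1 * gpsum m N chi eta).

Lemma psdil_chi_poly (s : K) z N :
  psdil s (chi_poly z N) = chi_poly (psdil s z) N.
Proof.
rewrite rmorph_sum; apply: eq_bigr => a _.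
by rewrite rmorphM /= psdil_cst rmorphXn.
Qed.

Lemma chi_poly_geo (eta : K) N n :
  chi_poly (psgeo eta 1) N n
    = \sum_(a < N) chi a%:Z * eta ^+ a * ((n`!%:R)^-1 * a%:R ^+ n).
Proof.
rewrite /chi_poly pssumE; apply: eq_bigr => a _.
by rewrite psgeoX // mulr1 /psgeo !pscstE mulrA.
Qed.

Lemma eq_psmul (f f' g g' : nat -> K) n :
  f =1 f' -> g =1 g' -> psmul f g n = psmul f' g' n.
Proof. by move=> /funext -> /funext ->. Qed.

Lemma horner_psmul (f g : nat -> {poly K}) (x : K) n :
  (psmul f g n).[x] = psmul (fun i => (f i).[x]) (fun i => (g i).[x]) n.
Proof. by rewrite /psmul horner_sum; apply: eq_bigr => i _; rewrite hornerM. Qed.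

(** The defining identity [gbernP] is evaluated at the scalar x, and then st is substituted for
    t. *)
Lemma bern_gen_eq (eta x s : K) :
  (psgeo eta s ^+ d - 1) * bern_gen eta x s
    = pscst s * pst K * psexpt (s * x) * chi_poly (psgeo eta s) d.
Proof.
have H : (psgeo eta 1 ^+ d - 1) * (fun n => (n`!%:R)^-1 * (gbern d chi eta n).[x])
    = pst K * (psexpt x * chi_poly (psgeo eta 1) d) :> pseries K.
  have gbP := gbernP (K := K) (d := d) chi eta K0 d_gt0.
  apply/funext => n; have := congr1 (fun f : nat -> {poly K} => (f n).[x]) gbP.
  rewrite /bern_num !horner_psmul !psmulE => E; apply: etrans (etrans E _) => {E}.
    apply: eq_psmul => i; last by rewrite [RHS]hornerZ.
    rewrite pssubE psoneE psgeoX // /psgeo pscstE /bern_den /psexp.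
    rewrite hornerD hornerN !hornerZ horner_exp -!polyC_natr !hornerC.
    by rewrite mulr1.
  apply: eq_psmul => i; first by rewrite -polyC_natr hornerC.
  rewrite horner_psmul; apply: eq_psmul => j.
    by rewrite /psexp hornerZ horner_exp hornerX.
  rewrite chi_poly_geo horner_sum.
  apply: eq_bigr => a _; rewrite !hornerZ horner_exp.
  by rewrite -polyC_natr hornerC.
have := congr1 (psdil s) H; rewrite !rmorphM rmorphB rmorphXn rmorph1 /= psdil_geo.
by rewrite psdil_t psdil_expt psdil_chi_poly psdil_geo mulr1 => ->; rewrite !mulrA.
Qed.

Lemma gpsum_gen_eq (N : nat) (eta s : K) :
  gpsum_gen N eta s = chi_poly (psgeo eta s) N.+1.
Proof.
rewrite -[s in RHS]mulr1 -psdil_geo -psdil_chi_poly; congr (psdil s _).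
apply/funext => n; rewrite chi_poly_geo /gpsum big_mkord big_distrr /=.
by apply: eq_bigr => a _; rewrite mulrCA.
Qed.

(** * The series symmetric in the pairwise products of the weights *)

Section Symmetric.
Variables (xi y1 y2 : K).

Let z (a : nat) : pseries K := psgeo (xi ^+ a) a%:R.

Definition sym_den (a1 a2 a3 : nat) : pseries K :=
  (z a1 ^+ d - 1) * (z a2 ^+ d - 1) * (z a3 ^+ d - 1).

Definition sym_num (W a1 a2 a3 : nat) : pseries K :=
  pscst W%:R * pst K ^+ 2 * psexpt (W%:R * (y1 + y2))
  * (chi_poly (z a1) d * chi_poly (z a2) d * chi_poly (z a3) d)
  * (z W ^+ d - 1).

(** Since [psdiv] is total, symmetry follows from that of numerator and denominator alone; that the
    quotient exists is shown in [trisum_sym_series]. *)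
Definition sym_series (W a1 a2 a3 : nat) : pseries K :=
  psdiv (sym_num W a1 a2 a3) (sym_den a1 a2 a3).

Lemma sym_seriesC12 W a1 a2 a3 : sym_series W a1 a2 a3 = sym_series W a2 a1 a3.
Proof.
rewrite /sym_series; have -> : sym_num W a1 a2 a3 = sym_num W a2 a1 a3.
  by rewrite /sym_num; ring.
suff -> : sym_den a1 a2 a3 = sym_den a2 a1 a3 by [].
by rewrite /sym_den; ring.
Qed.

Lemma sym_seriesC23 W a1 a2 a3 : sym_series W a1 a2 a3 = sym_series W a1 a3 a2.
Proof.
rewrite /sym_series; have -> : sym_num W a1 a2 a3 = sym_num W a1 a3 a2.
  by rewrite /sym_num; ring.
suff -> : sym_den a1 a2 a3 = sym_den a1 a3 a2 by [].
by rewrite /sym_den; ring.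
Qed.

Hypothesis xi_neq0 : xi != 0.

(* The products of the weights are parameters so as to match them in either
   order. *)
Lemma trisum_sym_series (w1 w2 w3 a1 a2 a3 W n : nat) :
    (0 < w1)%N -> (0 < w2)%N -> (0 < w3)%N ->
    a1 = (w2 * w3)%N -> a2 = (w1 * w3)%N -> a3 = (w1 * w2)%N ->
    W = (w1 * w2 * w3)%N ->
  trisum n (fun k l m =>
    (gbern d chi (xi ^+ a1) k).[w1%:R * y1]
    * (gbern d chi (xi ^+ a2) l).[w2%:R * y2]
    * gpsum m (d * w3 - 1)%N chi (xi ^+ a3)
    * w1%:R ^+ (l + m) * w2%:R ^+ (k + m) * w3%:R ^ ((k + l)%:Z - 1))
  = n`!%:R * sym_series W a1 a2 a3 n.
Proof.
move=> w1_gt0 w2_gt0 w3_gt0 a1E a2E a3E WE.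
have w3_neq0 := natr_neq0 w3_gt0.
(* The dilations give a1^k a2^l a3^m = w1^(l+m) w2^(k+m) w3^(k+l); the constant 1/w3 lowers the last
   exponent by one. *)
rewrite (trisumM K0 (f := bern_gen (xi ^+ a1) (w1%:R * y1) a1%:R)
  (g := bern_gen (xi ^+ a2) (w2%:R * y2) a2%:R)
  (h := pscst w3%:R^-1 * gpsum_gen (d * w3 - 1) (xi ^+ a3) a3%:R)); last first.
  move=> k l m; rewrite pscstE /bern_gen /gpsum_gen /psdil.
  rewrite expfzDr // exprN1 -exprnP a1E a2E a3E !natrM !exprMn !exprD.
  by field; rewrite w3_neq0 !fact_neq0.
congr (_ * _); set P := bern_gen _ _ _ * _.
suff -> : sym_series W a1 a2 a3 = P by [].
have regz a : (0 < a)%N -> GRing.lreg (z a ^+ d - 1).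
  by move=> a_gt0; apply: psgeoX_sub1_lreg; rewrite ?expf_neq0 ?natr_neq0.
have regD : GRing.lreg (sym_den a1 a2 a3).
  by apply: lregM; [apply: lregM|]; apply: regz;
    rewrite ?a1E ?a2E ?a3E muln_gt0 ?w1_gt0 ?w2_gt0 ?w3_gt0.
have DP : sym_den a1 a2 a3 * P = sym_num W a1 a2 a3.
  have H1 := bern_gen_eq (xi ^+ a1) (w1%:R * y1) a1%:R.
  have H2 := bern_gen_eq (xi ^+ a2) (w2%:R * y2) a2%:R.
  have cP a : pscst (chi (a + d)%N%:Z) = pscst (chi a%:Z).
    by rewrite PoszD chiP.
  have := periodic_geometric_sum (z a3) w3 cP.
  rewrite -/(chi_poly _ d) -/(chi_poly _ _) => H3.
  (* This is the common series Z = xi^W e^(Wt), the same whichever weight is singled out. *)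
  have ZE : z a3 ^+ w3 = z W.
    by rewrite /z psgeoX // -exprM -natrM WE a3E [(w3 * _)%N]mulnC.
  rewrite ZE in H3.
  (* Positivity undoes the truncated subtraction in [d * w3 - 1], so that the power sum covers
     exactly w3 periods. *)
  have dw_gt0 : (0 < d * w3)%N by rewrite muln_gt0 d_gt0.
  have E1 : a1%:R * (w1%:R * y1) = W%:R * y1.
    by rewrite mulrA -natrM WE a1E mulnC mulnA.
  have E2 : a2%:R * (w2%:R * y2) = W%:R * y2.
    by rewrite mulrA -natrM WE a2E mulnAC.
  (* The Bernoulli series contribute a1 t and a2 t; together with 1/w3 their constants give the
     symmetric factor W. *)
  have cst : pscst (w3%:R^-1 : K) * pscst a1%:R * pscst a2%:R = pscst (W%:R : K).
    rewrite -!pscstM WE a1E a2E !natrM; congr pscst; field; exact: w3_neq0.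
  rewrite E1 in H1; rewrite E2 in H2.
  rewrite /P gpsum_gen_eq subn1 prednK //.
  transitivity (pscst w3%:R^-1 * ((z a1 ^+ d - 1) * bern_gen (xi ^+ a1) (w1%:R * y1) a1%:R)
    * ((z a2 ^+ d - 1) * bern_gen (xi ^+ a2) (w2%:R * y2) a2%:R)
    * ((z a3 ^+ d - 1) * chi_poly (z a3) (d * w3))).
    by rewrite /sym_den -/(z a3); ring.
  rewrite H1 H2 H3 /sym_num -cst [W%:R * (_ + _)]mulrDr psexptD //; ring.
(* P itself witnesses that the quotient exists, and regularity of the denominator forces the chosen
   quotient to be P. *)
apply: regD; rewrite DP; apply: psdivE.
by exists P.
Qed.

End Symmetric.

End Generating.


(** * Reduction of the six expressions over C_p to the symmetric series *)

Theorem theorem4p2 (p : nat) (p_prime : prime p)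
    (R : realType) (Cp : fieldType) (v : Cp -> R) (HCp : is_Cp v p)
    (iota : {rmorphism algC -> Cp})
    (xi : Cp) (Hxi : in_Gamma_r p xi)
    (d : nat) (d_gt0 : (0 < d)%N)
    (chi0 : int -> algC) (Hchi : primitive_dirichlet d chi0)
    (w1 w2 w3 : nat) (w1_gt0 : (0 < w1)%N) (w2_gt0 : (0 < w2)%N)
    (w3_gt0 : (0 < w3)%N)
    (n : nat) (y1 y2 : Cp) (Hy1 : in_Zp v y1) (Hy2 : in_Zp v y2) :
  let chi := fun a : int => iota (chi0 a) in
  let B := fun (k : nat) (eta x : Cp) => (gbern d chi eta k).[x] in
  let S := fun (k N : nat) (eta : Cp) => gpsum k N chi eta in
  let E1 := trisum n (fun k l m =>
    B k (xi ^+ (w2 * w3)) (w1%:R * y1) * B l (xi ^+ (w1 * w3)) (w2%:R * y2)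
    * S m (d * w3 - 1)%N (xi ^+ (w1 * w2))
    * w1%:R ^+ (l + m) * w2%:R ^+ (k + m) * w3%:R ^ ((k + l)%:Z - 1)) in
  let E2 := trisum n (fun k l m =>
    B k (xi ^+ (w2 * w3)) (w1%:R * y1) * B l (xi ^+ (w1 * w2)) (w3%:R * y2)
    * S m (d * w2 - 1)%N (xi ^+ (w1 * w3))
    * w1%:R ^+ (l + m) * w3%:R ^+ (k + m) * w2%:R ^ ((k + l)%:Z - 1)) in
  let E3 := trisum n (fun k l m =>
    B k (xi ^+ (w1 * w3)) (w2%:R * y1) * B l (xi ^+ (w2 * w3)) (w1%:R * y2)
    * S m (d * w3 - 1)%N (xi ^+ (w1 * w2))
    * w2%:R ^+ (l + m) * w1%:R ^+ (k + m) * w3%:R ^ ((k + l)%:Z - 1)) in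
  let E4 := trisum n (fun k l m =>
    B k (xi ^+ (w1 * w3)) (w2%:R * y1) * B l (xi ^+ (w1 * w2)) (w3%:R * y2)
    * S m (d * w1 - 1)%N (xi ^+ (w2 * w3))
    * w2%:R ^+ (l + m) * w3%:R ^+ (k + m) * w1%:R ^ ((k + l)%:Z - 1)) in
  let E5 := trisum n (fun k l m =>
    B k (xi ^+ (w1 * w2)) (w3%:R * y1) * B l (xi ^+ (w1 * w3)) (w2%:R * y2)
    * S m (d * w1 - 1)%N (xi ^+ (w2 * w3))
    * w3%:R ^+ (l + m) * w2%:R ^+ (k + m) * w1%:R ^ ((k + l)%:Z - 1)) in
  let E6 := trisum n (fun k l m =>
    B k (xi ^+ (w1 * w2)) (w3%:R * y1) * B l (xi ^+ (w2 * w3)) (w1%:R * y2)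
    * S m (d * w2 - 1)%N (xi ^+ (w1 * w3))
    * w3%:R ^+ (l + m) * w1%:R ^+ (k + m) * w2%:R ^ ((k + l)%:Z - 1)) in
  [/\ E1 = E2, E2 = E3, E3 = E4, E4 = E5 & E5 = E6].
Proof.
move=> chi B S E1 E2 E3 E4 E5 E6.
have K0 := is_Cp_pchar0 p_prime HCp.
have chiP a : chi (a + d%:Z) = chi a.
  by rewrite /chi (dirichlet_periodic (proj1 Hchi)).
have xi_neq0 : xi != 0.
  have [s _ xiE] := Hxi; apply: contra_eq_neq xiE => ->.
  by rewrite expr0n expn_eq0 eqn0Ngt prime_gt0 // eq_sym oner_eq0.
pose W := (w1 * w2 * w3)%N.
pose Q := sym_series d chi xi y1 y2 W.
(* Each expression is the instance for one permutation of the weights, with W kept in a fixed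
   order. *)
have E w w' w'' a1 a2 a3 := @trisum_sym_series _ _ _ K0 d_gt0 chiP _ y1 y2 xi_neq0
  w w' w'' a1 a2 a3 W n.
have E1Q : E1 = n`!%:R * Q (w2 * w3)%N (w1 * w3)%N (w1 * w2)%N n by apply: E.
have E2Q : E2 = n`!%:R * Q (w2 * w3)%N (w1 * w2)%N (w1 * w3)%N n.
  by apply: E => //; rewrite /W; lia.
have E3Q : E3 = n`!%:R * Q (w1 * w3)%N (w2 * w3)%N (w1 * w2)%N n.
  by apply: E => //; rewrite /W; lia.
have E4Q : E4 = n`!%:R * Q (w1 * w3)%N (w1 * w2)%N (w2 * w3)%N n.
  by apply: E => //; rewrite /W; lia.
have E5Q : E5 = n`!%:R * Q (w1 * w2)%N (w1 * w3)%N (w2 * w3)%N n.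
  by apply: E => //; rewrite /W; lia.
have E6Q : E6 = n`!%:R * Q (w1 * w2)%N (w2 * w3)%N (w1 * w3)%N n.
  by apply: E => //; rewrite /W; lia.
have C12 a1 a2 a3 : Q a1 a2 a3 = Q a2 a1 a3 by apply: sym_seriesC12.
have C23 a1 a2 a3 : Q a1 a2 a3 = Q a1 a3 a2 by apply: sym_seriesC23.
(* Consecutive orderings of the pairwise products differ by one or two adjacent transpositions. *)
rewrite E1Q E2Q E3Q E4Q E5Q E6Q; split; congr (_ * _ n).
- exact: C23.
- by rewrite C23 C12.
- exact: C23.
- by rewrite C12.
- exact: C23.
Qed.
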